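(* Let $n\ge2$ and let $\lambda,\mu$ be integer partitions of $n$ with $\lambda\unlhd\mu$. If a set $D\subseteq S_n$ is $\lambda$-transitive, then $D$ is $\mu$-transitive.
   Context: $\Omega=\{1,\dots,n\}$ and $S_n=\mathrm{Sym}(\Omega)$. An integer partition of $n$ is a weakly decreasing sequence of positive integers with sum $n$. An ordered set partition of $\Omega$ is a tuple $P=(P_1,\dots,P_k)$ of pairwise disjoint non-empty subsets with union $\Omega$, with $|P_1|\ge\dots\ge|P_k|$; its shape is $(|P_1|,\dots,|P_k|)$. A permutation $g$ takes $P$ to $Q$ if $gP_i=Q_i$ (as sets) for every $i$. A set $D\subseteq S_n$ is $\lambda$-transitive if there is a constant $r_\lambda$ such that, for any two ordered set partitions $P,Q$ of shape $\lambda$, $D$ contains exactly $r_\lambda$ permutations taking $P$ to $Q$. Dominance order: $\lambda\unlhd\mu$ iff $\sum_{i=1}^j\lambda_i\le\sum_{i=1}^j\mu_i$ for all $j$ (missing parts are $0$). *)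

(* Defs.v *)
From mathcomp Require Import all_boot all_fingroup.

Set Implicit Arguments.
Unset Strict Implicit.
Unset Printing Implicit Defensive.

(* The ground set {1, .., n} is 'I_n, and Sym({1, .., n}) is 'S_n. *)

Definition is_intpart (n : nat) (l : seq nat) : bool :=
  [&& sorted geq l, all (fun p => 0 < p) l & sumn l == n].

(* Missing parts are 0, which is the default value of nth. *)
Definition dominated (l m : seq nat) : Prop :=
  forall j : nat, \sum_(i < j) nth 0 l i <= \sum_(i < j) nth 0 m i.

Definition shape_of (n : nat) (P : seq {set 'I_n}) : seq nat :=
  [seq #|A| | A : {set 'I_n} <- P].

Definition ordered_set_partition (n : nat) (P : seq {set 'I_n}) : bool :=
  [&& pairwise (fun A B : {set 'I_n} => [disjoint A & B]) P,
      all (fun A => A != set0) P,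
      \bigcup_(A <- P) A == [set: 'I_n]
    & sorted geq (shape_of P)].

Definition takes (n : nat) (g : 'S_n) (P Q : seq {set 'I_n}) : bool :=
  [seq g @: A | A : {set 'I_n} <- P] == Q.

Definition part_transitive (n : nat) (l : seq nat) (D : {set 'S_n}) : Prop :=
  exists r : nat, forall P Q : seq {set 'I_n},
    ordered_set_partition P -> shape_of P = l ->
    ordered_set_partition Q -> shape_of Q = l ->
    #|[set g in D | takes g P Q]| = r.

(* Main.v *)
Require Import Defs.
From mathcomp Require Import all_boot all_fingroup.
From mathcomp Require Import ssralg ssrnum ssrint zify.

(** An ordered set partition is the same thing as a colouring of the ground set
by row numbers, its shape being the sequence of sizes of the colour classes; a
permutation [g] takes one partition to another when [d (g x) = c x] for the
corresponding colourings [c] and [d].  Write [N c d] for the number of elements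
of [D] that do this.  Transitivity then makes sense for every weight
[w : nat -> nat], that is, every prescription of the sizes of the colour
classes, sorted or not.

The heart of the matter is the move of a single box from row [i] to row [j],
where [w j < w i]: transitivity for the new weight implies transitivity for [w]
([weight_transitive_move_box]).  Counting in two ways gives
[sum_carries_recolour]: the sum of [N (c with x recoloured j) e] over the [x]
of colour [i] in [c] equals the sum of [N c (e with z recoloured i)] over the
[z] of colour [j] in [e].  When [c] has weight [w] and [e] has the new weight,
all the terms on the left are the constant of the new weight, so the right-hand
side is known.  Let [V] be the union of the classes [i] and [j] of a colouring
[d], and let [h C] be [N c d'], where [d'] is [d] with [V] split anew into
[C], coloured [j], and its complement, coloured [i].  The identity now says that
the sum of [h] over the [w j]-subsets of any given [(w j).+1]-subset of [V] is a
known constant.  As [2 * w j < #|V|], the inclusion matrix of [b]-subsets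
against [b.+1]-subsets of [V], with [b = w j], is injective
([subset_sums_determine]), so that [h] is a known constant too, and [N c d] is
one of its values.

It remains to go from [mu] down to [lambda] by such moves
([weight_transitive_dominated]).  As the intermediate weights need not be
sorted, a box can be moved from any row [i] in excess to the first row [j] in
deficit, and dominance puts such an [i] before [j]. *)

Set Implicit Arguments.
Unset Strict Implicit.
Unset Printing Implicit Defensive.

(** * Functions on subsets of a given size and their sums over larger subsets *)

Section SubsetSums.
Import GRing.Theory Num.Theory.
Local Open Scope ring_scope.

(** Induction on [b].  For distinct [x] and [y], the difference
[h (x |: A) - h (y |: A)] is a function of the [b.-1]-subsets [A] of
[V :\ x :\ y], and its sums over [b]-subsets [A'] vanish: completed by
[h A'], its two halves are the given sums at [x |: A'] and [y |: A'].  So this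
difference is zero, whence [h] does not change when one point of its argument
is exchanged for another, and all the terms of the sum over a [b.+1]-subset are
equal. *)
Lemma subset_sums_determine (T : finType) (b : nat) (V : {set T})
    (R : numDomainType) (h : {set T} -> R) (s : R) :
  (b.*2 < #|V|)%N ->
  (forall C : {set T}, C \subset V -> #|C| = b.+1 ->
     \sum_(z in C) h (C :\ z) = s) ->
  forall C : {set T}, C \subset V -> #|C| = b -> h C *+ b.+1 = s.
Proof.
elim: b V h s => [|b IHb] V h s ltV hs C sCV cC.
  have /card_gt0P[z zV] := ltV.
  rewrite (cards0_eq cC) -(hs [set z]) ?sub1set ?cards1 //.
  by rewrite big_set1 setDv.
(* Exchanging a point of the argument does not change [h]. *)
have swap x y (A : {set T}) : x \in V -> y \in V -> x != y -> A \subset V :\ x :\ y ->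
    #|A| = b -> h (x |: A) = h (y |: A).
  move=> xV yV xy sA cA.
  have yVx : y \in V :\ x by rewrite !inE eq_sym xy.
  have cVxy := cardsD1 x V; have := cardsD1 y (V :\ x).
  rewrite xV in cVxy; rewrite yVx => cVxy'.
  have := IHb (V :\ x :\ y) (fun A => h (x |: A) - h (y |: A)) 0.
  move=> /(_ ltac:(lia)) /= IH.
  suff /eqP : (h (x |: A) - h (y |: A)) *+ b.+1 = 0.
    by rewrite mulrn_eq0 /= subr_eq0 => /eqP.
  apply: IH sA cA => A' sA' cA'.
  have nx : x \notin A'.
    by apply/negP=> /(subsetP sA'); rewrite !inE eqxx andbF.
  have ny : y \notin A'.
    by apply/negP=> /(subsetP sA'); rewrite !inE eqxx.
  have sA'V : A' \subset V.
    by apply: subset_trans sA' (subset_trans _ (subD1set V x)); apply: subD1set.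
  have side u : u \in V -> u \notin A' ->
      \sum_(z in A') h (u |: (A' :\ z)) = s - h A'.
    move=> uV nu; rewrite -(hs (u |: A')); last 2 first.
    - by rewrite subUset sub1set uV.
    - by rewrite cardsU1 nu cA'.
    rewrite big_setU1 //= setU1K // [RHS]addrC addKr.
    apply: eq_bigr => z zA; congr h; apply/setP=> t; rewrite !inE.
    case: (eqVneq t z) => [->|] //=; rewrite orbF.
    by apply/eqP=> E; rewrite -E zA in nu.
  by rewrite sumrB !side // subrr.
(* Any [w] outside [C] will do: the terms of the sum over [w |: C] are values
   of [h] at sets that come from [C] by an exchange with [w]. *)
have [w wV nw] : exists2 w, w \in V & w \notin C.
  apply/subsetPn/negP=> /subset_leq_card; lia.
rewrite -(hs (w |: C)); last 2 first.
- by rewrite subUset sub1set wV.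
- by rewrite cardsU1 nw cC.
have -> : b.+2 = #|w |: C| by rewrite cardsU1 nw cC.
rewrite -sumr_const; apply: eq_bigr => z; rewrite in_setU1.
case: (eqVneq z w) => [-> _|zw /= zC]; first by rewrite setU1K.
have -> : (w |: C) :\ z = w |: (C :\ z).
  apply/setP=> t; rewrite !inE; case: (eqVneq t w) => // ->.
  by rewrite eq_sym zw.
rewrite -{1}(setD1K zC); apply: swap => //; first exact: (subsetP sCV).
  apply/subsetP=> t; rewrite !inE => /andP[tz tC].
  rewrite tz (subsetP sCV) // !andbT.
  by apply/eqP=> E; rewrite -E tC in nw.
by have := cardsD1 z C; rewrite zC cC => -[].
Qed.

Lemma subset_sums_determine_nat (T : finType) (b : nat) (V : {set T})
    (h : {set T} -> nat) (s : nat) :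
  (b.*2 < #|V|)%N ->
  (forall C : {set T}, C \subset V -> #|C| = b.+1 ->
     (\sum_(z in C) h (C :\ z))%N = s) ->
  forall C : {set T}, C \subset V -> #|C| = b -> (h C * b.+1)%N = s.
Proof.
move=> ltV hs C sCV cC; apply/eqP; rewrite -(eqr_nat int) natrM mulr_natr.
apply/eqP; apply: (subset_sums_determine (h := fun C => (h C)%:R) ltV) => //.
by move=> C' sC' cC'; rewrite -(hs C') // natr_sum.
Qed.

End SubsetSums.

(** * Moving one box *)

Section Colourings.
Variable T : finType.
Implicit Types (c d e : T -> nat) (w : nat -> nat) (D : {set {perm T}}).

Definition fiber c (i : nat) : {set T} := [set x | c x == i].

Definition has_weight c w := forall i, #|fiber c i| = w i.

Definition carries c d (g : {perm T}) := [forall x, d (g x) == c x].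

Definition weight_transitive w D :=
  exists r : nat, forall c d, has_weight c w -> has_weight d w ->
    #|[set g in D | carries c d g]| = r.

Definition recolour c (x : T) (j : nat) := fun y => if y == x then j else c y.

Definition move_box w (i j : nat) :=
  fun k => if k == i then (w i).-1 else if k == j then (w j).+1 else w k.

Lemma eq_carries c d d' : d =1 d' -> carries c d =1 carries c d'.
Proof. by move=> E g; apply: eq_forallb => x; rewrite E. Qed.

(** Both sides say that [e (g y) = c y] for all [y] other than [x], while
[c x = i] and [e (g x) = j]. *)
Lemma carries_recolour c e (g : {perm T}) i j x :
  (c x == i) && carries (recolour c x j) e g
    = (e (g x) == j) && carries c (recolour e (g x) i) g.
Proof.
apply/andP/andP=> -[/eqP E /forallP H]; split.
- by have := H x; rewrite /recolour eqxx.
- apply/forallP=> y; have := H y; rewrite /recolour (inj_eq perm_inj).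
  by case: (eqVneq y x) => [->|]; rewrite ?E.
- by have := H x; rewrite /recolour eqxx eq_sym.
apply/forallP=> y; have := H y; rewrite /recolour (inj_eq perm_inj).
by case: (eqVneq y x) => [->|]; rewrite ?E.
Qed.

(** Both sums count pairs of a permutation [g] and a point, and
[carries_recolour] matches the pair of [g] and [x] with that of [g] and
[g x]. *)
Lemma sum_carries_recolour D c e i j :
  \sum_(x in fiber c i) #|[set g in D | carries (recolour c x j) e g]|
    = \sum_(z in fiber e j) #|[set g in D | carries c (recolour e z i) g]|.
Proof.
have count c' e' : #|[set g in D | carries c' e' g]|
    = \sum_(g in D) (carries c' e' g : nat).
  rewrite -sum1_card big_mkcond /= [RHS]big_mkcond /=.
  by apply: eq_bigr => g _; rewrite inE; case: (g \in D); case: carries.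
under eq_bigr do rewrite count.
under [RHS]eq_bigr do rewrite count.
rewrite exchange_big [RHS]exchange_big /=; apply: eq_bigr => g _.
rewrite big_mkcond [RHS]big_mkcond /= [RHS](reindex_inj (@perm_inj _ g)) /=.
apply: eq_bigr => x _; rewrite !inE; have := carries_recolour c e g i j x.
by do 2!case: eqP => _ //=; move=> <- // || move=> -> //.
Qed.

Lemma has_weight_recolour c w i j x : i != j -> c x = i ->
  has_weight c w -> has_weight (recolour c x j) (move_box w i j).
Proof.
move=> ij cx hw k; rewrite /move_box.
have xi : x \in fiber c i by rewrite inE cx.
case: (eqVneq k i) => [->|ki].
  have <- : fiber c i :\ x = fiber (recolour c x j) i.
    apply/setP=> y; rewrite !inE /recolour; case: (eqVneq y x) => //= _.
    by rewrite eq_sym (negbTE ij).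
  by have := cardsD1 x (fiber c i); rewrite xi -hw => ->.
case: (eqVneq k j) => [->|kj].
  have <- : x |: fiber c j = fiber (recolour c x j) j.
    by apply/setP=> y; rewrite !inE /recolour; case: (eqVneq y x) => //=; rewrite eqxx.
  by rewrite cardsU1 inE cx ij -hw.
rewrite -hw; congr #|pred_of_set _|; apply/setP=> y; rewrite !inE /recolour.
by case: (eqVneq y x) => // ->; rewrite cx eq_sym (negbTE kj) eq_sym (negbTE ki).
Qed.

(** The colouring [d] with [V] split anew: for [V] the union of the classes [i]
and [j] of [d], these are the colourings that differ from [d] only in how they
share out [V] between the two colours. *)
Definition split_by d (V C : {set T}) (i j : nat) :=
  fun x => if x \in V then (if x \in C then j else i) else d x.

(** The counts [N C] satisfy the hypothesis of [subset_sums_determine_nat] by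
double counting: in [sum_carries_recolour], with [e] the colouring
[split_by d V C i j] for a [(w j).+1]-subset [C], the left-hand side has [w i]
terms, each equal to the constant [r] of the moved weight. *)
Lemma weight_transitive_move_box D w i j : i != j -> w j < w i ->
  weight_transitive (move_box w i j) D -> weight_transitive w D.
Proof.
move=> ij lt_ji [r Hr].
exists ((w i * r) %/ (w j).+1) => c d hc hd.
pose V := fiber d i :|: fiber d j.
pose N C := #|[set g in D | carries c (split_by d V C i j) g]|.
have dij : [disjoint fiber d i & fiber d j].
  rewrite -setI_eq0; apply/eqP/setP=> x; rewrite !inE.
  by case: (d x =P i) => // ->; rewrite (negbTE ij).
have cV : #|V| = w i + w j by rewrite cardsU disjoint_setI0 // cards0 subn0 !hd.
have Nd : #|[set g in D | carries c d g]| = N (fiber d j).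
  apply: eq_card => g; rewrite !inE; congr (_ && _); apply: eq_carries => x.
  by rewrite /split_by !inE; case: (d x =P j) => [->|_]; rewrite ?orbT ?orbF //;
     case: eqP.
have NE : N (fiber d j) * (w j).+1 = w i * r.
  apply: (@subset_sums_determine_nat _ _ V) => [|C sCV cC||].
  - rewrite cV; lia.
  - have fj : fiber (split_by d V C i j) j = C.
      apply/setP=> x; rewrite !inE /split_by /V !inE.
      have := subsetP sCV x; rewrite /V !inE.
      case: (x \in C) => [-> //|_]; first exact: eqxx.
      case: (d x =P i) => [_|ni] /=; first exact: negbTE.
      case: (d x =P j) => [_|/eqP/negbTE ->//]; exact: negbTE.
    have he : has_weight (split_by d V C i j) (move_box w i j).
      move=> k; rewrite /move_box; case: (eqVneq k i) => [->|ki].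
        have -> : fiber (split_by d V C i j) i = V :\: C.
          apply/setP=> x; rewrite !inE /split_by /V !inE.
          case: (d x =P i) => [_|/eqP/negbTE ni] /=.
            by case: (x \in C) => /=; rewrite ?eqxx // eq_sym (negbTE ij).
          case: (d x =P j) => [_|_] /=; last by rewrite ni andbF.
          by case: (x \in C) => /=; rewrite ?eqxx // eq_sym (negbTE ij).
        by rewrite cardsD (setIidPr sCV) cV cC; lia.
      case: (eqVneq k j) => [->|kj]; first by rewrite fj.
      rewrite -hd; congr #|pred_of_set _|; apply/setP=> x.
      rewrite !inE /split_by /V !inE.
      have [ik jk] : (i == k) = false /\ (j == k) = false.
        by rewrite ![_ == k]eq_sym (negbTE ki) (negbTE kj).
      case: (d x =P i) => [->|_] /=; first by case: ifP; rewrite ?ik ?jk.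
      by case: (d x =P j) => [->|//]; case: ifP; rewrite ?ik ?jk.
    have := sum_carries_recolour D c (split_by d V C i j) i j.
    rewrite fj (eq_bigr (fun=> r)); last first.
      by move=> x; rewrite inE => /eqP cx; apply: Hr => //; apply: has_weight_recolour.
    rewrite sum_nat_const hc => ->; apply: eq_bigr => z zC.
    apply: eq_card => g; rewrite !inE; congr (_ && _); apply: eq_carries => x.
    rewrite /split_by /recolour !inE; case: (eqVneq x z) => //= ->.
    by have := subsetP sCV z zC; rewrite !inE => ->.
  - exact: subsetUr.
  - exact: hd.
by rewrite Nd -NE mulnK.
Qed.

End Colourings.

(** * Descending the dominance order *)

Lemma eq_weight_transitive (T : finType) (w w' : nat -> nat)
    (D : {set {perm T}}) :
  w =1 w' -> weight_transitive w D -> weight_transitive w' D.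
Proof.
by move=> E [r Hr]; exists r => c d hc hd; apply: Hr => k; rewrite E.
Qed.

Lemma ltn_sum_ord t (F G : 'I_t -> nat) i :
  (forall k, F k <= G k) -> F i < G i -> \sum_(k < t) F k < \sum_(k < t) G k.
Proof.
move=> leFG ltFG; rewrite (bigD1 i) //= [ltnRHS](bigD1 i) //= -addSn.
by apply: leq_add => //; apply: leq_sum.
Qed.

(** The partial sums change only between the two rows; having the correction
terms on both sides avoids subtraction and lets [i] and [j] come in either
order. *)
Lemma sum_move_box w i j t : i != j -> 0 < w i ->
  \sum_(k < t) move_box w i j k + (i < t) = \sum_(k < t) w k + (j < t).
Proof.
move=> ij wi; elim: t => [|t IH]; first by rewrite !big_ord0.
rewrite !big_ord_recr /=; set S' := \sum_(k < t) _ in IH *.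
set S := \sum_(k < t) _ in IH *; rewrite /move_box.
rewrite !ltnS [i <= t]leq_eqVlt [j <= t]leq_eqVlt ![_ == t]eq_sym.
case: (eqVneq t i) => [ti|_] /=.
  by rewrite ti ltnn (negbTE ij) in IH *; lia.
case: (eqVneq t j) => [tj|_] /=; last by rewrite addnAC IH addnAC.
by rewrite tj ltnn in IH *; rewrite addnAC IH; lia.
Qed.

(** Induction on the total excess of [u] over [l].  If [j] is the first row
where [u] falls short of [l], dominance at [j.+1] gives a row [i < j] where [u]
exceeds [l]; then [u j < l j <= l i < u i], so a box may be moved from [i] to
[j].  The partial sums of lengths in [i.+1 .. j] drop by one, but they exceeded
those of [l] strictly, as [u] is at least [l] in all rows before [j].  Only [l]
is required to be nonincreasing, since the moved weight need not be. *)
Lemma weight_transitive_dominated (T : finType) (D : {set {perm T}}) m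
    (l u : nat -> nat) :
  (forall i j, i <= j -> l j <= l i) ->
  (forall t, \sum_(k < t) l k <= \sum_(k < t) u k) ->
  \sum_(k < m) l k = \sum_(k < m) u k ->
  (forall k, m <= k -> l k = 0 /\ u k = 0) ->
  weight_transitive l D -> weight_transitive u D.
Proof.
move=> mono dom tot supp Dl.
have [N] := ubnP (\sum_(k < m) (u k - l k)).
elim: N u dom tot supp => // N IH u dom tot supp; rewrite ltnS => leN.
(* With no row in deficit, equality of the totals forces [u] to be [l]. *)
have [/existsP[j0 ltj0]|] := boolP [exists j : 'I_m, u j < l j]; last first.
  rewrite negb_exists => /forallP ge; apply: eq_weight_transitive Dl => k.
  have [/supp[-> ->//]|km] := leqP m k.
  apply/eqP; rewrite eqn_leq; have := ge (Ordinal km); rewrite -leqNgt /= => -> /=.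
  rewrite leqNgt; apply/negP=> lt.
  have: \sum_(k < m) l k < \sum_(k < m) u k.
    by apply: (@ltn_sum_ord _ _ _ (Ordinal km)) => // k'; rewrite leqNgt; apply: ge.
  by rewrite tot ltnn.
have exj : exists j, u j < l j by exists j0.
case: (ex_minnP exj) => j ltj minj.
have below k : k < j -> l k <= u k.
  by move=> kj; rewrite leqNgt; apply/negP=> /minj; rewrite leqNgt kj.
have [/existsP[[i ij] /= lti]|] := boolP [exists i : 'I_j, l i < u i]; last first.
  rewrite negb_exists => /forallP le.
  have := dom j.+1; rewrite leqNgt => /negP[].
  apply: (@ltn_sum_ord _ _ _ ord_max) => // k.
  have [kj|jk] := ltnP k j; first by have := le (Ordinal kj); rewrite -leqNgt.
  by have -> : k = j :> nat; [have := ltn_ord k; lia | apply: ltnW].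
have lij := mono _ _ (ltnW ij).
have nij : i != j by rewrite neq_ltn ij.
have jm : j < m by rewrite ltnNge; apply/negP=> /supp[E _]; rewrite E in ltj.
have im : i < m by apply: ltn_trans jm.
have smb t := @sum_move_box u i j t nij (leq_ltn_trans (leq0n _) lti).
apply: (weight_transitive_move_box nij); first lia.
apply: IH.
- (* Only [i < t <= j] needs the strict inequality. *)
  move=> t; have := smb t; have := dom t.
  case: (ltnP i t) => it; case: (ltnP j t) => jt; try lia.
  suff: \sum_(k < t) l k < \sum_(k < t) u k by lia.
  apply: (@ltn_sum_ord _ _ _ (Ordinal it)) => // k.
  by apply: below; apply: leq_trans jt.
- by have := smb m; rewrite im jm tot => /addIn ->.
- move=> k mk; have [-> uk] := supp k mk; split=> //.
  by rewrite /move_box !gtn_eqF //; apply: leq_trans mk.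
apply: leq_trans leN; apply: (@ltn_sum_ord _ _ _ (Ordinal im)) => /= [k|].
  rewrite /move_box; case: eqP => [->|_]; first lia.
  by case: eqP => [->|_]; lia.
by rewrite /move_box eqxx; lia.
Qed.

(** * Ordered set partitions as colourings *)

Section Translation.
Variable n : nat.
Implicit Types (P Q : seq {set 'I_n}) (c d : 'I_n -> nat) (l : seq nat).

Definition part_index P (x : 'I_n) := find (fun A : {set 'I_n} => x \in A) P.

Definition parts m c : seq {set 'I_n} := mkseq (fiber c) m.

(** Disjointness makes the part found first the only one containing [x], and
covering makes every [x] lie in some part, so that the classes beyond the last
part are empty, in agreement with the default value. *)
Lemma fiber_part_index P i :
  ordered_set_partition P -> fiber (part_index P) i = nth set0 P i.
Proof.
case/and4P=> /(pairwiseP set0) disjP _ /eqP coverP _.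
apply/setP=> x; rewrite inE.
have hasx : has (fun A : {set 'I_n} => x \in A) P.
  have : x \in \bigcup_(A <- P) A by rewrite coverP inE.
  rewrite bigcup_seq => /bigcupP[A AP xA]; by apply/hasP; exists A.
have xk := nth_find set0 hasx; rewrite /= -/(part_index P x) in xk.
have ltk : part_index P x < size P by rewrite -has_find.
apply/eqP/idP => [<- //|xi].
have lti : i < size P.
  by rewrite ltnNge; apply/negP=> /(nth_default set0) E; rewrite E inE in xi.
case: (ltngtP (part_index P x) i) => // lt.
  by have /disjointFr/(_ xk) := disjP _ i ltk lti lt; rewrite xi.
by have /disjointFr/(_ xi) := disjP i _ lti ltk lt; rewrite xk.
Qed.

Lemma has_weight_part_index P : ordered_set_partition P ->
  has_weight (part_index P) (nth 0 (shape_of P)).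
Proof.
move=> oP i; rewrite fiber_part_index //.
have [lt|ge] := ltnP i (size P); first by rewrite (nth_map set0).
by rewrite !nth_default ?size_map // cards0.
Qed.

Lemma parts_part_index P : ordered_set_partition P ->
  parts (size P) (part_index P) = P.
Proof.
move=> oP; rewrite /parts (eq_mkseq (g := nth set0 P)) ?mkseq_nth //.
by move=> i; apply: fiber_part_index.
Qed.

(** A colour beyond the length of [l] has an empty class, by the default value
[0]; so the classes of the first [size l] colours cover the ground set. *)
Lemma has_weight_lt_size c l x : has_weight c (nth 0 l) -> c x < size l.
Proof.
move=> hc; rewrite ltnNge; apply/negP=> /(nth_default 0); rewrite -hc.
by move/cards0_eq/setP/(_ x); rewrite !inE eqxx.
Qed.

Lemma shape_of_parts c l : has_weight c (nth 0 l) -> shape_of (parts (size l) c) = l.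
Proof.
move=> hc; rewrite /shape_of /parts /mkseq -map_comp -[RHS](mkseq_nth 0).
exact: eq_map.
Qed.

Lemma ordered_set_partition_parts c l : is_intpart n l ->
  has_weight c (nth 0 l) -> ordered_set_partition (parts (size l) c).
Proof.
case/and3P=> sl pl _ hc; apply/and4P; split.
- apply/(pairwiseP set0) => i j; rewrite !inE size_mkseq => il jl ij.
  rewrite !nth_mkseq // -setI_eq0; apply/eqP/setP=> x; rewrite !inE.
  by apply/andP=> -[/eqP-> /eqP E]; rewrite E ltnn in ij.
- apply/allP=> A /mapP[i]; rewrite mem_iota => /= il ->.
  by rewrite -card_gt0 hc (allP pl) // mem_nth.
- apply/eqP/setP=> x; rewrite inE bigcup_seq; apply/bigcupP.
  exists (fiber c (c x)); last by rewrite inE.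
  by apply: map_f; rewrite mem_iota; apply: has_weight_lt_size hc.
by rewrite shape_of_parts.
Qed.

Lemma takes_parts m c d (g : 'S_n) : (forall x, c x < m) ->
  takes g (parts m c) (parts m d) = carries c d g.
Proof.
move=> cm; rewrite /takes /parts /mkseq -map_comp.
apply/eqP/forallP => [/eq_in_map E x|H].
  have /E/setP/(_ (g x)) /= : c x \in iota 0 m by rewrite mem_iota /= cm.
  rewrite mem_imset; last exact: perm_inj.
  by rewrite !inE eqxx => <-.
apply: eq_map => i /=; apply/setP=> y; rewrite -(permKV g y).
rewrite mem_imset; last exact: perm_inj.
by rewrite !inE (eqP (H _)).
Qed.

Lemma part_transitiveP l (D : {set 'S_n}) : is_intpart n l ->
  part_transitive l D <-> weight_transitive (nth 0 l) D.
Proof.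
move=> il; split=> -[r Hr]; exists r.
  move=> c d hc hd.
  rewrite -(Hr (parts (size l) c) (parts (size l) d)) ?shape_of_parts //;
    try exact: ordered_set_partition_parts.
  apply: eq_card => g; rewrite !inE takes_parts // => x.
  exact: has_weight_lt_size hc.
move=> P Q oP sP oQ sQ.
have hP := has_weight_part_index oP; have hQ := has_weight_part_index oQ.
rewrite sP in hP; rewrite sQ in hQ; rewrite -(Hr _ _ hP hQ).
apply: eq_card => g; rewrite !inE.
rewrite -{1}(parts_part_index oP) -{1}(parts_part_index oQ).
have -> : size P = size l by rewrite -sP size_map.
have -> : size Q = size l by rewrite -sQ size_map.
by rewrite takes_parts // => x; apply: has_weight_lt_size hP.
Qed.

End Translation.

Lemma sum_nth_sumn (l : seq nat) m :
  size l <= m -> \sum_(k < m) nth 0 l k = sumn l.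
Proof.
move=> lm; rewrite sumnE (big_nth 0) big_mkord.
rewrite (big_ord_widen m (nth 0 l) lm) [RHS]big_mkcond /=.
by apply: eq_bigr => k _; case: ltnP => // /(nth_default 0).
Qed.

Lemma nth_intpart_mono n (l : seq nat) i j :
  is_intpart n l -> i <= j -> nth 0 l j <= nth 0 l i.
Proof.
case/and3P=> sl _ _ ij; have [jl|/(nth_default 0)-> //] := ltnP j (size l).
have tr : transitive geq by move=> y x z /= xy yz; apply: leq_trans xy.
exact: (sorted_leq_nth tr leqnn 0 sl) (leq_ltn_trans ij jl) jl ij.
Qed.

Theorem theorem5 (n : nat) (hn : 2 <= n) (lambda mu : seq nat)
  (hlambda : is_intpart n lambda) (hmu : is_intpart n mu)
  (hdom : dominated lambda mu) (D : {set 'S_n}) :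
  part_transitive lambda D -> part_transitive mu D.
Proof.
move=> /(part_transitiveP _ hlambda) Dl; apply/(part_transitiveP _ hmu).
pose m := maxn (size lambda) (size mu).
apply: (weight_transitive_dominated (m := m)) Dl => //.
- by move=> i j; apply: nth_intpart_mono hlambda.
- rewrite !sum_nth_sumn ?leq_maxr ?leq_maxl //.
  by case/and3P: hlambda => _ _ /eqP->; case/and3P: hmu => _ _ /eqP->.
move=> k; rewrite geq_max => /andP[lk mk].
by rewrite !nth_default.
Qed.
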